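(* The conjugator length functions of affine Coxeter groups and of split crystallographic groups grow linearly. That is: (i) if $W$ is an affine Coxeter group, then the conjugator length function of $W$ grows linearly; (ii) if $H = T_H \rtimes H_0 \le \operatorname{Isom}(\mathbb{E}^n)$ is a split crystallographic group, then the conjugator length function of $H$ grows linearly.
   Context: Write $\operatorname{Isom}(\mathbb{E}^n) = T \rtimes \operatorname{O}(n)$, where $T \cong \mathbb{R}^n$ is the group of translations of Euclidean $n$-space. A subgroup $H$ of $\operatorname{Isom}(\mathbb{E}^n)$ is split if $H = T_H \rtimes H_0$ with $T_H = T \cap H$ (translation part) and $H_0 = H \cap \operatorname{O}(n)$ (spherical part). A crystallographic group is a discrete cocompact subgroup of $\operatorname{Isom}(\mathbb{E}^n)$. An affine Coxeter group is viewed as the group generated by affine reflections of a Euclidean space, which is the semidirect product of its translation group (by the coroot lattice) and a finite reflection group. These groups are discrete and finitely generated. For a group $G$ with finite generating set $S$ and word length $\ell_S$, and conjugate $h, h' \in G$, put $\mathrm{c}\ell(h,h') = \min\{\ell_S(k) : khk^{-1} = h' \text{ in } G\}$. For $m \in \mathbb{N} = \{0,1,2,\dots\}$ the conjugator length function is $\operatorname{CL}(m) = \sup\{\mathrm{c}\ell(h,h') : h, h' \text{ conjugate in } G,\ \ell_S(h) + \ell_S(h') \le m\}$, with the convention that $\operatorname{CL}$ is constant equal to zero if $G$ is abelian. It is extended to $r \in \mathbb{R}_{\ge 0}$ by $\operatorname{CL}(r) = \operatorname{CL}(\lceil r \rceil)$. For nondecreasing $f, g : \mathbb{R}_{\ge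 0} \to \mathbb{R}_{\ge 0}$, write $f \preccurlyeq g$ if there is an increasing affine function $a(r) = Cr + D$ with $C, D \in \mathbb{R}$, $C > 0$, such that $f(r) \le a(g(a(r)))$ for all $r \ge 0$ with $a(r) \ge 0$; $f$ and $g$ are quasi-equivalent if $f \preccurlyeq g$ and $g \preccurlyeq f$. The function $f$ grows linearly if it is quasi-equivalent to $r \mapsto r$. The growth rate (quasi-equivalence class) of $\operatorname{CL}$ does not depend on the choice of $S$.
   Formalization: In (ii) H is assumed non-abelian, and in (i) W has rank at least 1: for abelian H (e.g. Z^n acting by translations) or the trivial group, CL is constantly 0 by convention and hence does not grow linearly. *)

(* Defs.v *)
From HB Require Import structures.
From mathcomp Require Import all_boot all_order all_algebra.
From mathcomp Require Import all_classical all_reals all_analysis.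

Set Implicit Arguments.
Unset Strict Implicit.
Unset Printing Implicit Defensive.

Import Order.TTheory GRing.Theory Num.Theory.
Import numFieldNormedType.Exports.

Local Open Scope classical_set_scope.
Local Open Scope ring_scope.

Definition is_subgroup (G : groupType) (H : set G) : Prop :=
  [/\ H 1%g,
      forall x y, H x -> H y -> H (x * y)%g
    & forall x, H x -> H (x^-1)%g].

Definition subgroup_gen (G : groupType) (S : set G) : set G :=
  smallest (@is_subgroup G) S.

Definition is_abelian (G : groupType) (H : set G) : Prop :=
  forall x y, H x -> H y -> commute x y.

Definition is_sdprod (G : groupType) (H N K : set G) : Prop :=
  [/\ is_subgroup N /\ is_subgroup K,
      forall h x, H h -> N x -> N (h * x * h^-1)%g,
      N `&` K = [set 1%g]
    & H = [set (x * y)%g | x in N & y in K]].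

Definition finite_generating_set (G : groupType) (H S : set G) : Prop :=
  finite_set S /\ subgroup_gen S = H.

(* The least element of A; the default value 0 is returned only if A is
   empty. *)
Definition natmin (A : set nat) : nat :=
  xget 0%N [set m | A m /\ forall k, A k -> (m <= k)%N].

Definition is_word (G : groupType) (S : set G) (w : seq G) : Prop :=
  forall x, x \in w -> S x \/ S (x^-1)%g.

Definition word_length (G : groupType) (S : set G) (g : G) : nat :=
  natmin [set size w | w in
            [set w : seq G | is_word S w /\ (\prod_(x <- w) x)%g = g]].

Definition conjugators (G : groupType) (H : set G) (h h' : G) : set G :=
  [set k | H k /\ (k * h * k^-1)%g = h'].

Definition conj_length (G : groupType) (H S : set G) (h h' : G) : nat :=
  natmin (word_length S @` conjugators H h h').

(* S being finite, the supremum is taken over a finite set, which contains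
   cl(1,1) = 0.  If H is abelian the value is 0, since then
   cl(h,h) = l_S(1) = 0 for every h. *)
Definition CL (R : realType) (G : groupType) (H S : set G) (m : nat) : R :=
  sup [set (conj_length H S p.1 p.2)%:R | p in
         [set p : G * G |
           [/\ H p.1, H p.2, conjugators H p.1 p.2 !=set0
             & (word_length S p.1 + word_length S p.2 <= m)%N]]].

(* Only used for r >= 0, where |ceil r| = ceil r. *)
Definition CL_real (R : realType) (G : groupType) (H S : set G) (r : R) : R :=
  CL R H S `|Num.ceil r|%N.

(* Functions on the nonnegative reals are represented by total functions, of
   which only the values at r >= 0 matter. *)
Definition preceq (R : realType) (f g : R -> R) : Prop :=
  exists C D : R, 0 < C /\
    forall r, 0 <= r -> 0 <= C * r + D -> f r <= C * g (C * r + D) + D.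

Definition quasi_equivalent (R : realType) (f g : R -> R) : Prop :=
  preceq f g /\ preceq g f.

Definition grows_linearly (R : realType) (f : R -> R) : Prop :=
  quasi_equivalent f id.

(* The growth rate of CL does not depend on the finite generating set; linear
   growth is therefore required for all of them, of which there is at least
   one. *)
Definition CL_grows_linearly (R : realType) (G : groupType) (H : set G) : Prop :=
  (exists S, finite_generating_set H S) /\
  forall S, finite_generating_set H S -> grows_linearly (CL_real (R := R) H S).

Definition dot (R : realType) (n : nat) (x y : 'cV[R]_n) : R :=
  \sum_(i < n) x i 0 * y i 0.

(* Isom(E^n) as the semidirect product of R^n by O(n): the pair (t, A) stands
   for the isometry x |-> A x + t. *)
Definition isom_pred (R : realType) (n : nat) : pred ('cV[R]_n * 'M[R]_n) :=
  fun p => p.2^T *m p.2 == 1%:M.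

Record isom (R : realType) (n : nat) := Isom {
  isom_val :> 'cV[R]_n * 'M[R]_n;
  isom_valP : isom_pred isom_val }.

HB.instance Definition _ (R : realType) (n : nat) :=
  [isSub for @isom_val R n].
HB.instance Definition _ (R : realType) (n : nat) :=
  [Choice of isom R n by <:].

Section IsomGroup.
Variables (R : realType) (n : nat).
Implicit Types g h : isom R n.

Definition isom_tr g : 'cV[R]_n := (isom_val g).1.
Definition isom_lin g : 'M[R]_n := (isom_val g).2.

Definition isom_act g (x : 'cV[R]_n) : 'cV[R]_n := isom_lin g *m x + isom_tr g.

Lemma isom_linTK g : (isom_lin g)^T *m isom_lin g = 1%:M.
Proof. exact/eqP/(isom_valP g). Qed.

Lemma isom_linKT g : isom_lin g *m (isom_lin g)^T = 1%:M.
Proof. exact/mulmx1C/isom_linTK. Qed.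

Fact isom_one_subproof : @isom_pred R n (0, 1%:M).
Proof. by rewrite /isom_pred /= trmx1 mulmx1. Qed.

Fact isom_mul_subproof g h :
  @isom_pred R n (isom_lin g *m isom_tr h + isom_tr g, isom_lin g *m isom_lin h).
Proof.
by rewrite /isom_pred /= trmx_mul mulmxA -(mulmxA _ _ (isom_lin g)) isom_linTK
           mulmx1 isom_linTK.
Qed.

Fact isom_inv_subproof g :
  @isom_pred R n (- ((isom_lin g)^T *m isom_tr g), (isom_lin g)^T).
Proof. by rewrite /isom_pred /= trmxK isom_linKT. Qed.

Definition isom_one : isom R n := Isom isom_one_subproof.
Definition isom_mul g h : isom R n := Isom (isom_mul_subproof g h).
Definition isom_inv g : isom R n := Isom (isom_inv_subproof g).

Fact isom_mulA : associative isom_mul.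
Proof.
move=> g h k; apply: val_inj; congr pair; rewrite /isom_tr /isom_lin /=.
  by rewrite mulmxDr mulmxA addrA.
by rewrite mulmxA.
Qed.

Fact isom_mul1g : left_id isom_one isom_mul.
Proof.
move=> g; apply: val_inj; rewrite /= /isom_tr /isom_lin /=.
by rewrite !mul1mx addr0 -surjective_pairing.
Qed.

Fact isom_mulg1 : right_id isom_one isom_mul.
Proof.
move=> g; apply: val_inj; rewrite /= /isom_tr /isom_lin /=.
by rewrite mulmx0 mulmx1 add0r -surjective_pairing.
Qed.

Fact isom_mulVg : left_inverse isom_one isom_inv isom_mul.
Proof.
move=> g; apply: val_inj; congr pair; first exact: subrr.
exact: isom_linTK.
Qed.

Fact isom_mulgV : right_inverse isom_one isom_inv isom_mul.
Proof.
move=> g; apply: val_inj; congr pair; last exact: isom_linKT.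
rewrite /isom_tr /isom_lin /= mulmxN mulmxA.
by have := isom_linKT g; rewrite /isom_lin => ->; rewrite mul1mx addNr.
Qed.

HB.instance Definition _ :=
  isGroup.Build (isom R n)
    isom_mulA isom_mul1g isom_mulg1 isom_mulVg isom_mulgV.

(* The topology of Isom(E^n) is induced by that of R^n x M_n(R). *)
HB.instance Definition _ :=
  Topological.copy (isom R n) (@initial_topology (isom R n) ('cV[R]_n * 'M[R]_n)%type (@isom_val R n)).

Lemma isom_actM g h x : isom_act (g * h)%g x = isom_act g (isom_act h x).
Proof. by rewrite /isom_act mulmxDr mulmxA addrA. Qed.

End IsomGroup.

Definition translation_part (R : realType) (n : nat) (H : set (isom R n)) :
    set (isom R n) := H `&` [set g | isom_lin g = 1%:M].

Definition spherical_part (R : realType) (n : nat) (H : set (isom R n)) :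
    set (isom R n) := H `&` [set g | isom_tr g = 0].

Definition is_split (R : realType) (n : nat) (H : set (isom R n)) : Prop :=
  is_sdprod H (translation_part H) (spherical_part H).

Definition is_discrete (R : realType) (n : nat) (H : set (isom R n)) : Prop :=
  H `<=` isolated H.

(* Cocompactness of the action of H on E^n. *)
Definition is_cocompact (R : realType) (n : nat) (H : set (isom R n)) : Prop :=
  exists K : set 'cV[R]_n,
    compact K /\ \bigcup_(h in H) (isom_act h @` K) = setT.

Definition is_crystallographic (R : realType) (n : nat) (H : set (isom R n)) :
    Prop :=
  [/\ is_subgroup H, is_discrete H & is_cocompact H].

Definition coroot (R : realType) (n : nat) (a : 'cV[R]_n) : 'cV[R]_n :=
  (2 / dot a a) *: a.

(* The orthogonal reflection in the affine hyperplane (x, a) = k. *)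
Definition affine_reflection (R : realType) (n : nat) (a : 'cV[R]_n) (k : R)
    (x : 'cV[R]_n) : 'cV[R]_n := x - (dot x a - k) *: coroot a.

(* Reduced crystallographic root systems spanning R^n, not necessarily
   irreducible. *)
Definition is_root_system (R : realType) (n : nat) (Phi : seq 'cV[R]_n) : Prop :=
  [/\ 0 \notin Phi /\ <<Phi>>%VS = fullv,
      {in Phi &, forall a b, affine_reflection a 0 b \in Phi},
      {in Phi &, forall a b, dot b (coroot a) \is a Num.int}
    & forall (a : 'cV[R]_n) (c : R), a \in Phi -> c *: a \in Phi ->
        c = 1 \/ c = -1].

Definition affine_weyl (R : realType) (n : nat) (Phi : seq 'cV[R]_n) :
    set (isom R n) :=
  subgroup_gen [set g : isom R n | exists2 a, a \in Phi &
                  exists k : int, isom_act g =1 affine_reflection a k%:~R].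

(* Any rank is allowed except 0, which would give the trivial group. *)
Definition is_affine_coxeter (R : realType) (n : nat) (W : set (isom R n)) :
    Prop :=
  exists Phi : seq 'cV[R]_n,
    [/\ Phi != [::], is_root_system Phi & W = affine_weyl Phi].

(* Main.v *)
Require Import Defs.
From HB Require Import structures.
From mathcomp Require Import all_boot all_order all_algebra.
From mathcomp Require Import all_classical all_reals all_analysis.
From mathcomp Require Import ring lra.
From mathcomp Require Import zify.

(* Both kinds of groups are of the form H = L x| P with L a lattice and P a
   finite group of orthogonal matrices; elements are pairs (t, A) standing for
   x |-> A x + t, and word length is comparable to |t| + 1.

   Upper bound: (s, B) conjugates (t, A) to (t', A') iff A' = B A B^-1 and
   (1 - A') s = t' - B t.  If some s in L solves this, then so does one of norm
   O(|t' - B t|), because (1 - A') L is relatively dense in its span: a point v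
   of it is reached from 0 in O(|v|) + 1 steps taken in a fixed finite subset.

   Lower bound: for A <> 1 in P and b in L with (1 - A) b <> 0, the elements
   (0, A) and (m (1 - A) b, A) are conjugate by (m b, 1), and any conjugator
   (s, B) satisfies (1 - A) s = m (1 - A) b, so that m = O(|s|). *)

Set Implicit Arguments.
Unset Strict Implicit.
Unset Printing Implicit Defensive.

Import Order.TTheory GRing.Theory Num.Def Num.Theory.
Import numFieldNormedType.Exports.

Local Open Scope classical_set_scope.
Local Open Scope ring_scope.

(** * Minima of sets of natural numbers, and generated subgroups *)

Lemma natminP (A : set nat) :
  A !=set0 -> A (natmin A) /\ forall k, A k -> (natmin A <= k)%N.
Proof.
move=> [a Aa]; pose P k := `[< A k >].
have exP : exists k, P k by exists a; apply/asboolP.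
have mP : [set m | A m /\ forall k, A k -> (m <= k)%N] (ex_minn exP).
  case: ex_minnP => m /asboolP Am mmin.
  by split=> // k Ak; apply/mmin/asboolP.
exact: (xgetPex 0%N (ex_intro _ _ mP)).
Qed.

Lemma natmin_le (A : set nat) k : A k -> (natmin A <= k)%N.
Proof. by move=> Ak; case: (natminP (ex_intro _ _ Ak)) => _; apply. Qed.

Lemma finite_bounded_nat (T : Type) (A : set T) (f : T -> nat) :
  finite_set A -> exists C, forall x, A x -> (f x <= C)%N.
Proof.
move=> /(finite_image f)/finite_seqP[s sE].
exists (\max_(i <- s) i)%N => x Ax; apply: leq_bigmax_seq => //.
suff : [set` s] (f x) by [].
by rewrite -sE; exists x.
Qed.

Lemma subgroup_subgroup_gen (G : groupType) (S : set G) :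
  is_subgroup (subgroup_gen S).
Proof.
split=> [M [[]]//|x y Sx Sy M MS|x Sx M MS].
- by have [_ + _] := MS.1; apply; [apply: Sx|apply: Sy].
- by have [_ _] := MS.1; apply; apply: Sx.
Qed.

(** * Word length *)

Section WordLength.
Variables (G : groupType) (S : set G).

Lemma is_word_cat w1 w2 : is_word S w1 -> is_word S w2 -> is_word S (w1 ++ w2).
Proof. by move=> S1 S2 x; rewrite mem_cat => /orP[/S1|/S2]. Qed.

Lemma is_word_inv w : is_word S w ->
  exists2 w', is_word S w' & (\prod_(x <- w') x)%g = (\prod_(x <- w) x)^-1%g.
Proof.
elim: w => [|x w IH] Sw; first by exists [::] => //; rewrite !big_nil invg1.
have [|w' Sw' w'E] := IH; first by move=> y yw; apply: Sw; rewrite inE yw orbT.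
exists (w' ++ [:: x^-1%g]).
  apply: is_word_cat => // y; rewrite inE => /eqP ->.
  by rewrite invgK; case: (Sw x (mem_head _ _)) => ?; [right|left].
by rewrite big_cat /= big_seq1 big_cons w'E invgM.
Qed.

Lemma prod_word_in (H : set G) w : is_subgroup H -> S `<=` H ->
  is_word S w -> H (\prod_(x <- w) x)%g.
Proof.
move=> [H1 HM HV] SH; elim: w => [|x w IH] Sw; first by rewrite big_nil.
rewrite big_cons; apply: HM; last first.
  by apply: IH => y yw; apply: Sw; rewrite inE yw orbT.
case: (Sw x (mem_head _ _)) => /SH //.
by move=> /HV; rewrite invgK.
Qed.

Lemma subgroup_gen_wordP g :
  subgroup_gen S g <-> exists2 w, is_word S w & (\prod_(x <- w) x)%g = g.
Proof.
split=> [|[w Sw <-]]; last first.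
  apply: prod_word_in Sw; first exact: subgroup_subgroup_gen.
  exact: sub_gen_smallest.
pose P : set G := [set g | exists2 w, is_word S w & (\prod_(x <- w) x)%g = g].
apply: (@smallest_sub _ _ _ P).
  split.
  - by exists [::] => //; rewrite big_nil.
  - move=> _ _ [w1 S1 <-] [w2 S2 <-].
    by exists (w1 ++ w2); [exact: is_word_cat|rewrite big_cat].
  - by move=> _ [w /is_word_inv[w' Sw' w'E] <-]; exists w'.
move=> x Sx; exists [:: x]; last by rewrite big_seq1.
by move=> y; rewrite inE => /eqP ->; left.
Qed.

Lemma word_length_le w : is_word S w ->
  (word_length S (\prod_(x <- w) x)%g <= size w)%N.
Proof. by move=> Sw; apply: natmin_le; exists w. Qed.

Lemma word_length1 : word_length S 1%g = 0%N.
Proof.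
apply/eqP; rewrite -leqn0.
by have := @word_length_le [::]; rewrite big_nil; apply.
Qed.

Lemma word_lengthP g : subgroup_gen S g ->
  exists w, [/\ is_word S w, (\prod_(x <- w) x)%g = g
              & size w = word_length S g].
Proof.
move=> /subgroup_gen_wordP[w Sw wE].
have [|[w' [Sw' w'E] szw'] _] :=
  @natminP [set size w | w in
    [set w | is_word S w /\ (\prod_(x <- w) x)%g = g]].
  by exists (size w), w.
by exists w'.
Qed.

Lemma word_lengthM g h : subgroup_gen S g -> subgroup_gen S h ->
  (word_length S (g * h)%g <= word_length S g + word_length S h)%N.
Proof.
move=> /word_lengthP[w [Sw <- <-]] /word_lengthP[w' [Sw' <- <-]].
by rewrite -big_cat -size_cat; apply/word_length_le/is_word_cat.
Qed.

Lemma word_length_prod_le (I : Type) (s : seq I) (f : I -> G) C :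
  (forall i, subgroup_gen S (f i) /\ (word_length S (f i) <= C)%N) ->
  (word_length S (\prod_(i <- s) f i)%g <= C * size s)%N.
Proof.
move=> fS; have [S1 SM SV] := subgroup_subgroup_gen S.
have prodS r : subgroup_gen S (\prod_(i <- r) f i)%g.
  by apply: big_ind => // i _; case: (fS i).
elim: s => [|i s IH].
  by rewrite big_nil word_length1.
rewrite big_cons mulnS; have [Si li] := fS i.
by apply: leq_trans (word_lengthM Si (prodS s)) _; apply: leq_add.
Qed.

End WordLength.

(** * Conjugator length *)

Section ConjugatorLength.
Variables (R : realType) (G : groupType) (H S : set G).

Lemma conj_length_le h h' k : conjugators H h h' k ->
  (conj_length H S h h' <= word_length S k)%N.
Proof. by move=> ck; apply: natmin_le; exists k. Qed.

Lemma conj_lengthP h h' : conjugators H h h' !=set0 ->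
  exists2 k, conjugators H h h' k & word_length S k = conj_length H S h h'.
Proof.
move=> [k ck].
have [|[k' ck' kE] _] := @natminP (word_length S @` conjugators H h h').
  by exists (word_length S k), k.
by exists k'.
Qed.

Hypothesis groupH : is_subgroup H.
Variable K : nat.
Hypothesis conj_length_ub : forall h h', H h -> H h' ->
  conjugators H h h' !=set0 ->
  (conj_length H S h h' <= K * (word_length S h + word_length S h') + K)%N.

Let CL_set m : set R := [set (conj_length H S p.1 p.2)%:R | p in
  [set p : G * G | [/\ H p.1, H p.2, conjugators H p.1 p.2 !=set0
     & (word_length S p.1 + word_length S p.2 <= m)%N]]].

Lemma CL_set_ub m : ubound (CL_set m) (K * m + K)%:R.
Proof.
move=> _ [[h h'] /= [Hh Hh' cl lm] <-]; rewrite ler_nat.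
apply: leq_trans (conj_length_ub Hh Hh' cl) _.
by rewrite leq_add2r leq_mul2l lm orbT.
Qed.

Lemma CL_le m : CL R H S m <= (K * m + K)%:R.
Proof.
apply: ge_sup; last exact: CL_set_ub.
have [H1 _ _] := groupH.
exists (conj_length H S 1 1)%g%:R; exists (1, 1)%g => //; split=> //=.
  by exists 1%g; split=> //; rewrite invg1 !mulg1.
by rewrite word_length1.
Qed.

(** The upper bound on conjugator lengths enters this lower estimate too: [sup] is sure to dominate
    the elements only of a set that is bounded above. *)
Lemma conj_length_le_CL m h h' : H h -> H h' -> conjugators H h h' !=set0 ->
  (word_length S h + word_length S h' <= m)%N ->
  (conj_length H S h h')%:R <= CL R H S m.
Proof.
move=> Hh Hh' cl lm; apply: ub_le_sup; first by eexists; exact: CL_set_ub.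
by exists (h, h').
Qed.

(** The affine reparametrisation absorbs rounding and additive constants. For the lower bound, one
    hard pair for each m suffices. The slope [K + 1] is positive even for K = 0. *)
Lemma CL_real_grows_linearly :
  (forall m : nat, exists h h', [/\ H h, H h', conjugators H h h' !=set0,
     (word_length S h + word_length S h' <= K * m + K)%N
   & (m <= K * conj_length H S h h')%N]) ->
  grows_linearly (CL_real (R := R) H S).
Proof.
move=> conj_length_lb; split.
  exists (K%:R + 1), (2 * K%:R + 1); split; first by rewrite ltr_wpDl.
  move=> r r0 _; rewrite /CL_real; apply: le_trans (CL_le _) _.
  have c0 : (0 <= Num.ceil r)%R by rewrite ceil_ge0; lra.
  have cr : (`|Num.ceil r|%N)%:R <= r + 1 :> R.
    have -> : (`|Num.ceil r|%N)%:R = (Num.ceil r)%:~R :> R.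
      by rewrite -[in RHS](gez0_abs c0).
    by have := ceilB1_lt r; rewrite intrB; lra.
  rewrite natrD natrM /=; set k := K%:R; have k0 : 0 <= k :> R by rewrite ler0n.
  have : k * (`|Num.ceil r|%N)%:R <= k * (r + 1) by rewrite ler_wpM2l.
  have : 0 <= k * r by rewrite mulr_ge0.
  have : 0 <= k * k by rewrite mulr_ge0.
  have : 0 <= k * k * r by rewrite !mulr_ge0.
  by lra.
(* For m = ceil r the length budget K m + K is at most K (r + 1) + K = K r + 2 K, whence the
   offset. *)
exists (K%:R + 1), (2 * K%:R); split; first by rewrite ltr_wpDl.
move=> r r0 _ /=.
set k := K%:R; have k0 : 0 <= k :> R by rewrite ler0n.
have c0 : (0 <= Num.ceil r)%R by rewrite ceil_ge0; lra.
pose m := `|Num.ceil r|%N.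
have mE : m%:R = (Num.ceil r)%:~R :> R by rewrite -[in RHS](gez0_abs c0).
have [h [h' [Hh Hh' cl lm mcl]]] := conj_length_lb m.
have /(conj_length_le_CL Hh Hh' cl) clCL :
    (word_length S h + word_length S h' <= `|Num.ceil ((k + 1) * r + 2 * k)|)%N.
  apply: leq_trans lm _; rewrite -(ler_nat R).
  set t := (k + 1) * r + 2 * k.
  have t0 : (0 <= Num.ceil t)%R.
    by rewrite ceil_ge0 /t; have := mulr_ge0 k0 r0; lra.
  have -> : (`|Num.ceil t|%N)%:R = (Num.ceil t)%:~R :> R.
    by rewrite -[in RHS](gez0_abs t0).
  apply: le_trans (ceil_ge t); rewrite natrD natrM mE.
  have : k * (Num.ceil r)%:~R <= k * (r + 1).
    by rewrite ler_wpM2l//; have := ceilB1_lt r; rewrite intrB; lra.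
  by rewrite /t -/k; lra.
have rm : r <= m%:R by rewrite mE ceil_ge.
move: mcl; rewrite -(ler_nat R) natrM -/k => mcl.
have clCL' : k * (conj_length H S h h')%:R <=
    k * CL R H S `|Num.ceil ((k + 1) * r + 2 * k)| by rewrite ler_wpM2l.
have := ler0n R (conj_length H S h h').
by rewrite /CL_real; lra.
Qed.

End ConjugatorLength.

(** * The maximum norm of matrices, and finiteness of bounded separated sets *)

Section MatrixNorm.
Variable R : realType.

Lemma ler_mx_norm m n (A : 'M[R]_(m, n)) (c : R) :
  0 <= c -> (forall i j, `|A i j| <= c) -> `|A| <= c.
Proof.
move=> c0 Ac; rewrite [leLHS]/normr /= mx_normrE.
by apply/bigmax_leP; split=> // -[i j].
Qed.

Lemma entry_le_mx_norm m n (A : 'M[R]_(m, n)) i j : `|A i j| <= `|A|.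
Proof.
rewrite [leRHS]/normr /= mx_normrE.
by apply/bigmax_geP; right; exists (i, j).
Qed.

(** The norm is the largest absolute value of an entry; the factor n counts the terms in each entry
    of a product. *)
Lemma mx_norm_mulmx_le m n p (A : 'M[R]_(m, n)) (B : 'M[R]_(n, p)) :
  `|A *m B| <= n%:R * `|A| * `|B|.
Proof.
apply: ler_mx_norm => [|i j]; first by rewrite !mulr_ge0.
rewrite mxE; apply: le_trans (ler_norm_sum _ _ _) _.
apply: le_trans (_ : \sum_(k < n) `|A| * `|B| <= _).
  by apply: ler_sum => k _; rewrite normrM ler_pM// entry_le_mx_norm.
by rewrite sumr_const card_ord -[_ *+ n]mulr_natl mulrA.
Qed.

(** Cut the cube of radius r into cells of side [delta]: two points of E in one cell differ by less
    than [delta] in every coordinate, so they coincide, and there are finitely many cells. *)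
Lemma bounded_separated_finite (T : Type) (I : finType) (E : set T)
    (f : T -> I -> R) (r delta : R) : 0 < delta ->
  (forall x i, E x -> `|f x i| <= r) ->
  (forall x y, E x -> E y -> (forall i, `|f x i - f y i| < delta) -> x = y) ->
  finite_set E.
Proof.
move=> delta0 Er Esep.
pose q x i := Num.floor ((f x i + r) / delta).
pose N := `|Num.floor (2 * r / delta)|%N.
have q0 x i : E x -> (0 <= q x i).
  move=> Ex; rewrite floor_ge0 divr_ge0 ?(ltW delta0)//.
  by have := Er _ i Ex; rewrite ler_norml => /andP[]; lra.
have qN x i : E x -> (`|q x i| < N.+1)%N.
  move=> Ex; rewrite ltnS -lez_nat gez0_abs ?q0//.
  have qle : q x i <= Num.floor (2 * r / delta).
    apply: le_floor; rewrite ler_pM2r ?invr_gt0//.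
    by have := Er _ i Ex; rewrite ler_norml => /andP[]; lra.
  by rewrite gez0_abs// (le_trans (q0 x i Ex)).
pose g x : {ffun I -> 'I_N.+1} := [ffun i => inord `|q x i|%N].
(* [None] marks the points outside E, so that E becomes the preimage of a finite set under a map
   injective on E. *)
pose h x := if `[< E x >] then Some (g x) else None.
have hE : E = h @^-1` [set~ None].
  by rewrite predeqE => x; rewrite /preimage/= /h; case: asboolP.
rewrite hE; apply: finite_preimage; last exact: finite_finset.
move=> x y; rewrite -hE !inE => Ex Ey; rewrite /h !asboolT// => -[/ffunP gE].
apply: Esep => // i.
have := gE i; rewrite !ffunE => /(congr1 (@nat_of_ord _)).
rewrite !inordK ?qN// => qE.
have {}qE : q x i = q y i by rewrite -[LHS]gez0_abs ?q0// qE gez0_abs ?q0.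
have := floor_itv ((f x i + r) / delta).
have := floor_itv ((f y i + r) / delta).
rewrite -/(q x i) -/(q y i) qE intrD => /andP[y1 y2] /andP[x1 x2].
have : `|(f x i + r) / delta - (f y i + r) / delta| < 1.
  by rewrite ltr_norml; apply/andP; split; lra.
rewrite -mulrBl normrM normfV (gtr0_norm delta0) ltr_pdivrMr// mul1r.
by congr (`|_| < _); ring.
Qed.

End MatrixNorm.

(** * Isometries of Euclidean space *)

Section IsomTheory.
Variables (R : realType) (n : nat).
Implicit Types g h k : isom R n.

Lemma isom_inj g h : isom_tr g = isom_tr h -> isom_lin g = isom_lin h -> g = h.
Proof.
move=> trE linE; apply: val_inj => /=.
by rewrite [LHS]surjective_pairing [RHS]surjective_pairing; congr pair.
Qed.

Lemma isom_trM g h :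
  isom_tr (g * h)%g = isom_lin g *m isom_tr h + isom_tr g.
Proof. by []. Qed.

Lemma isom_linM g h : isom_lin (g * h)%g = isom_lin g *m isom_lin h.
Proof. by []. Qed.

Lemma isom_trV g : isom_tr g^-1%g = - ((isom_lin g)^T *m isom_tr g).
Proof. by []. Qed.

Lemma isom_linV g : isom_lin g^-1%g = (isom_lin g)^T.
Proof. by []. Qed.

Lemma isom_tr1 : isom_tr (1%g : isom R n) = 0. Proof. by []. Qed.

Lemma isom_lin1 : isom_lin (1%g : isom R n) = 1%:M. Proof. by []. Qed.

Lemma isom_act_inj g h : isom_act g =1 isom_act h -> g = h.
Proof.
move=> gh; have trE : isom_tr g = isom_tr h.
  by have := gh 0; rewrite /isom_act !mulmx0 !add0r.
apply: isom_inj => //; apply/matrixP => i j.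
have := gh (delta_mx j 0); rewrite /isom_act trE => /addIr.
by move=> /matrixP/(_ i 0); rewrite -!colE !mxE.
Qed.

(** The columns of an orthogonal matrix are unit vectors. *)
Lemma isom_lin_norm_le1 g : `|isom_lin g| <= 1.
Proof.
apply: ler_mx_norm => // i j; have := isom_linTK g.
move=> /matrixP/(_ j j); rewrite !mxE eqxx mulr1n.
rewrite (bigD1 i)//= !mxE -expr2 => sqE.
rewrite -(@ler_pXn2r _ 2) ?nnegrE// expr1n.
rewrite (real_normK (num_real _)) -sqE lerDl.
by apply: sumr_ge0 => k _; rewrite mxE -expr2 sqr_ge0.
Qed.

Lemma isom_lin_mul_le g m (x : 'M[R]_(n, m)) :
  `|isom_lin g *m x| <= n%:R * `|x|.
Proof.
apply: le_trans (mx_norm_mulmx_le _ _) _.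
by rewrite ler_wpM2r// ler_piMr ?isom_lin_norm_le1.
Qed.

Fact translation_subproof (t : 'cV[R]_n) : @isom_pred R n (t, 1%:M).
Proof. by rewrite /isom_pred /= trmx1 mulmx1. Qed.

Definition translation t := Isom (translation_subproof t).

(** This is (0, A) for g = (t, A), written as a product so that it visibly lies in every subgroup
    containing g and the translation by t. *)
Definition rotation g := (translation (- isom_tr g) * g)%g.

Lemma translation_tr t : isom_tr (translation t) = t. Proof. by []. Qed.

Lemma translation_lin t : isom_lin (translation t) = 1%:M. Proof. by []. Qed.

Lemma translationD s t :
  translation (s + t) = (translation s * translation t)%g.
Proof.
apply: isom_inj.
  by rewrite [RHS]isom_trM !translation_tr translation_lin mul1mx addrC.
by rewrite [RHS]isom_linM !translation_lin mul1mx.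
Qed.

Lemma translation0 : translation 0 = 1%g.
Proof. exact: isom_inj. Qed.

Lemma translationN t : translation (- t) = (translation t)^-1%g.
Proof.
apply: isom_inj.
  by rewrite [RHS]isom_trV !translation_tr translation_lin trmx1 mul1mx.
by rewrite [RHS]isom_linV !translation_lin trmx1.
Qed.

Lemma translation_sum (I : Type) (s : seq I) (f : I -> 'cV[R]_n) :
  translation (\sum_(i <- s) f i) = (\prod_(i <- s) translation (f i))%g.
Proof.
elim: s => [|i s IH]; first by rewrite !big_nil translation0.
by rewrite !big_cons translationD IH.
Qed.

Lemma rotation_tr g : isom_tr (rotation g) = 0.
Proof. by rewrite [LHS]isom_trM translation_lin mul1mx subrr. Qed.

Lemma rotation_lin g : isom_lin (rotation g) = isom_lin g.
Proof. by rewrite [LHS]isom_linM translation_lin mul1mx. Qed.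

Lemma translation_rotation g : g = (translation (isom_tr g) * rotation g)%g.
Proof. by rewrite /rotation mulgA -translationD subrr translation0 mul1g. Qed.

(** Left multiplication spreads the separation from 1 over all of H: if g and h have close entries,
    then g^-1 h is close to 1, up to a factor n for the matrix of g^-1. *)
Lemma uniformly_discrete_ball_finite (H : set (isom R n)) (e r : R) :
  is_subgroup H -> 0 < e ->
  (forall g, H g -> `|isom_tr g| < e -> `|isom_lin g - 1%:M| < e -> g = 1%g) ->
  finite_set [set g | H g /\ `|isom_tr g| <= r].
Proof.
move=> [H1 HM HV] e0 disc.
pose f g (i : 'I_n + 'I_n * 'I_n) : R := match i with
  | inl i => isom_tr g i 0 | inr ij => isom_lin g ij.1 ij.2 end.
(* The aim is n d < e; dividing by n + 1 covers n = 0. *)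
pose d := e / (n.+1)%:R / 2.
have d0 : 0 < d by rewrite !divr_gt0.
have nd : n%:R * d < e.
  have -> : n%:R * d = e * (n%:R / n.+1%:R / 2) by rewrite /d; ring.
  rewrite gtr_pMr// ltr_pdivrMr// mul1r ltr_pdivrMr// -natrM ltr_nat; lia.
apply: (bounded_separated_finite (f := f) (r := Num.max r 1) d0).
  move=> g [i|[i j]] [Hg gr] /=; rewrite le_max.
    by rewrite (le_trans (entry_le_mx_norm _ _ _) gr).
  by rewrite (le_trans (entry_le_mx_norm _ _ _) (isom_lin_norm_le1 _)) orbT.
move=> g h [Hg _] [Hh _] fgh.
have gVh m (x y : 'M[R]_(n, m)) : (forall i j, `|x i j - y i j| < d) ->
    `|isom_lin g^-1%g *m (y - x)| < e.
  move=> xy; apply: le_lt_trans (isom_lin_mul_le _ _) _.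
  apply: le_lt_trans nd; rewrite ler_wpM2l//.
  apply: ler_mx_norm => [|i j]; first exact: ltW.
  by rewrite !mxE distrC ltW.
suff : (g^-1 * h)%g = 1%g by move/(canRL (mulVKg _)); rewrite mulg1.
apply: disc; first exact/HM/Hh/HV.
  rewrite isom_trM isom_trV isom_linV -mulmxBr -isom_linV.
  by apply: gVh => i j; rewrite !ord1; exact: (fgh (inl i)).
rewrite isom_linM -[1%:M](isom_linTK g) isom_linV -mulmxBr -isom_linV.
by apply: gVh => i j; exact: (fgh (inr (i, j))).
Qed.

End IsomTheory.

(** * Lattices extended by finite point groups *)

Section LatticeByPointGroup.
Variables (R : realType) (n : nat) (H : set (isom R n)).
Implicit Types g h : isom R n.

(** The translations of H as vectors. The hypotheses that follow (H is split, 1 is uniformly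
    isolated, L is relatively dense) are what each of the two families of groups has to supply. *)
Let L : set 'cV[R]_n := [set t | H (translation t)].

Hypothesis groupH : is_subgroup H.
Hypothesis translationH : forall g, H g -> L (isom_tr g).
Variables e D : R.
Hypothesis e_gt0 : 0 < e.
Hypothesis discreteH : forall g, H g ->
  `|isom_tr g| < e -> `|isom_lin g - 1%:M| < e -> g = 1%g.
Hypothesis denseL : forall x, exists2 t, L t & `|x - t| <= D.

Lemma latticeD s t : L s -> L t -> L (s + t).
Proof. by have [_ HM _] := groupH; rewrite /L/= translationD; exact: HM. Qed.

Lemma lattice0 : L 0.
Proof. by have [H1 _ _] := groupH; rewrite /L/= translation0. Qed.

Lemma latticeN t : L t -> L (- t).
Proof. by have [_ _ HV] := groupH; rewrite /L/= translationN; exact: HV. Qed.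

Lemma lattice_sum (k : nat) (u : 'I_k -> 'cV[R]_n) :
  (forall i, L (u i)) -> L (\sum_i u i).
Proof.
by move=> Lu; apply: big_ind => [|x y|i _]; [exact: lattice0|exact: latticeD|].
Qed.

Lemma lattice_natmul t m : L t -> L (t *+ m).
Proof.
move=> Lt; elim: m => [|m IH]; first by rewrite mulr0n; exact: lattice0.
by rewrite mulrS; exact: latticeD.
Qed.

Lemma rotation_in g : H g -> H (rotation g).
Proof.
move=> Hg; have [_ HM _] := groupH.
by apply: HM => //; apply/latticeN/translationH.
Qed.

Lemma lattice_lin g t : H g -> L t -> L (isom_lin g *m t).
Proof.
move=> Hg Lt; have [_ HM HV] := groupH.
have := translationH (HM _ _ (rotation_in Hg) Lt).
by rewrite isom_trM rotation_tr addr0 rotation_lin translation_tr.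
Qed.

Lemma lattice_ball_finite r : finite_set [set t | L t /\ `|t| <= r].
Proof.
have := uniformly_discrete_ball_finite r groupH e_gt0 discreteH.
move=> /(finite_image (@isom_tr R n)); apply: sub_finite_set => t [Lt tr].
by exists (translation t).
Qed.

(* Subdividing the segment from 0 to t into k pieces and moving the division
   points to nearby points of L writes t as a sum of k elements of L whose
   images under M are uniformly bounded. *)
Lemma lattice_image_short_sums (M : 'M[R]_n) :
  (forall t, L t -> L (M *m t)) ->
  exists2 F : set 'cV[R]_n, finite_set F /\ F `<=` L &
    forall t (k : nat), L t -> `|M *m t| <= k%:R ->
      exists2 u : 'I_k -> 'cV[R]_n, (forall i, F (u i))
        & M *m t = M *m \sum_i u i.
Proof.
move=> ML; pose c := n%:R * `|M|.
have c0 : 0 <= c by rewrite mulr_ge0.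
have Mle (x : 'cV[R]_n) : `|M *m x| <= c * `|x| by exact: mx_norm_mulmx_le.
have D0 : 0 <= D.
  by have [t _] := denseL 0; apply: le_trans.
(* Under M, a step t / k has norm at most 1; moving its two endpoints by at most D each adds at most
   2 c D. *)
pose r := 1 + 2 * c * D.
pose B := [set M *m t | t in L] `&` [set v | `|v| <= r].
have finB : finite_set B.
  apply: sub_finite_set (lattice_ball_finite r).
  by move=> v [[t Lt <-] /= vr]; split=> //; exact: ML.
(* Only the images under M are bounded, hence finite in number; the differences of division points
   can be long if M has a kernel. So one preimage in L is fixed for each image. *)
pose lift v := xget 0 [set t | L t /\ M *m t = v].
have liftP v : B v -> L (lift v) /\ M *m lift v = v.
  move=> [[t Lt tv] _]; rewrite /lift.
  by apply: (@xgetPex _ 0 [set s | L s /\ M *m s = v]); exists t.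
exists (lift @` B).
  by split; [exact: finite_image|move=> _ [v Bv <-]; case: (liftP v Bv)].
move=> t [|k] Lt tk.
  (* For k = 0 the bound forces M t = 0, the empty sum. *)
  exists (fun=> 0); first by case.
  by rewrite big_ord0 mulmx0; apply/eqP; rewrite -normr_le0.
have [p pP] := choice (fun i : nat => let: ex_intro2 s Ls sD :=
  denseL ((i%:R / k.+1%:R) *: t) in
  ex_intro (fun s => L s /\ _) s (conj Ls sD)).
(* The endpoints stay exactly at 0 and t, so that the sum telescopes to M t. *)
pose q i := if i == 0%N then 0 else if i == k.+1 then t else p i.
have qP (i : nat) : L (q i) /\ `|(i%:R / k.+1%:R) *: t - q i| <= D.
  rewrite /q; case: eqVneq => [->|i0].
    by rewrite mul0r scale0r subr0 normr0; split=> //; exact: lattice0.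
  case: eqVneq => [->|_]; last exact: pP.
  by rewrite divff// scale1r subrr normr0.
have Bq (i : 'I_k.+1) : B (M *m (q i.+1 - q i)).
  have [Lq qD] := qP i; have [Lq' qD'] := qP i.+1.
  split; first by exists (q i.+1 - q i) => //; exact/latticeD/latticeN.
  rewrite /=; set x := _ *: t in qD; set x' := _ *: t in qD'.
  have -> : q i.+1 - q i = (x' - x) + ((x - q i) - (x' - q i.+1)).
    by move: x x' {qD qD'} => x x'; apply/matrixP => a b; rewrite !mxE; ring.
  rewrite mulmxDr; apply: le_trans (ler_normD _ _) _; apply: lerD.
    have -> : x' - x = k.+1%:R^-1 *: t.
      by rewrite /x /x' -scalerBl -mulrBl -natrB// subSnn mul1r.
    rewrite -scalemxAr normrZ normfV normr_nat ler_pdivrMl// mulr1.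
    exact: tk.
  apply: le_trans (Mle _) _; have -> : 2 * c * D = c * (2 * D) by ring.
  apply: ler_wpM2l => //.
  by apply: le_trans (ler_normB _ _) _; rewrite mulr2n mulrDl !mul1r lerD.
exists (fun i : 'I_k.+1 => lift (M *m (q i.+1 - q i))) => [i|].
  by exists (M *m (q i.+1 - q i)).
rewrite mulmx_sumr.
transitivity (\sum_(i < k.+1) (M *m q i.+1 - M *m q i)).
  rewrite -(big_mkord xpredT (fun i => M *m q i.+1 - M *m q i)).
  by rewrite telescope_sumr// /q eqxx /= mulmx0 subr0.
by apply: eq_bigr => i _; rewrite (liftP _ (Bq i)).2 mulmxBr.
Qed.

(** The short sum is itself the preimage wanted: it has k terms from a finite set. With M = 1 - A
    this shortens the translation part of a conjugator. *)
Lemma bounded_preimage (M : 'M[R]_n) : (forall t, L t -> L (M *m t)) ->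
  exists C : nat, forall t (k : nat), L t -> `|M *m t| <= k%:R ->
    exists2 s, L s /\ M *m s = M *m t & `|s| <= (C * k)%:R.
Proof.
move=> ML; have [F [finF FL] Fsum] := lattice_image_short_sums ML.
have [C FC] :=
  finite_bounded_nat (fun s : 'cV[R]_n => Num.truncn `|s| + 1)%N finF.
exists C => t k Lt tk; have [u Fu ->] := Fsum t k Lt tk.
exists (\sum_i u i).
  by split=> //; apply: lattice_sum => i; exact: FL.
apply: le_trans (ler_norm_sum _ _ _) _.
apply: le_trans (_ : \sum_(i < k) C%:R <= _); last first.
  by rewrite sumr_const card_ord natrM mulr_natr.
apply: ler_sum => i _; have := FC _ (Fu i); rewrite addn1 => uC.
apply: le_trans (ltW (truncnS_gt _)) _.
by rewrite ler_nat.
Qed.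

Lemma finitely_generated :
  exists S : set (isom R n), finite_generating_set H S.
Proof.
have [_ HM _] := groupH.
have [t Lt|F [finF FL] Fsum] := lattice_image_short_sums (M := 1%:M).
  by rewrite mul1mx.
(* The point group, written as a ball of radius 0 so that the finiteness of balls applies. With M =
   1, F generates all translations of H. *)
pose P := [set g | H g /\ `|isom_tr g| <= 0].
exists ([set translation t | t in F] `|` P); split.
  rewrite finite_setU; split; first exact: finite_image.
  exact: uniformly_discrete_ball_finite groupH e_gt0 discreteH.
apply/seteqP; split.
  apply: smallest_sub => // g [[t Ft <-]|[]//]; exact: FL.
set S := (X in subgroup_gen X); move=> g Hg.
have [S1 SM _] := subgroup_subgroup_gen S.
rewrite (translation_rotation g); apply: (SM); last first.
  apply: sub_gen_smallest; right; split; first exact: rotation_in.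
  by rewrite rotation_tr normr0.
have [u Fu] := Fsum _ (Num.truncn `|isom_tr g|).+1 (translationH Hg)
  (ltac:(rewrite mul1mx; exact/ltW/truncnS_gt)).
rewrite !mul1mx => ->; rewrite translation_sum.
apply: big_ind => // i _.
by apply: sub_gen_smallest; left; exists (u i).
Qed.

(** A - 1 kills L, and m x is within D of L, so m |(A - 1) x| stays bounded as m grows. *)
Lemma lin_fixes_lattice (A : 'M[R]_n) :
  (forall t, L t -> A *m t = t) -> A = 1%:M.
Proof.
move=> At; suff AB0 (x : 'cV[R]_n) : (A - 1%:M) *m x = 0.
  apply/eqP; rewrite -subr_eq0; apply/eqP/matrixP => i j.
  by have /matrixP/(_ i 0) := AB0 (delta_mx j 0); rewrite -colE !mxE.
pose c := n%:R * `|A - 1%:M| * D.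
have xc (m : nat) : m%:R * `|(A - 1%:M) *m x| <= c.
  have [t Lt xt] := denseL (m%:R *: x).
  have -> : m%:R * `|(A - 1%:M) *m x| = `|(A - 1%:M) *m (m%:R *: x - t)|.
    have At0 : (A - 1%:M) *m t = 0 by rewrite mulmxBl mul1mx At// subrr.
    by rewrite mulmxBr -[in RHS]scalemxAr At0 subr0 normrZ normr_nat.
  by apply: le_trans (mx_norm_mulmx_le _ _) _; rewrite ler_wpM2l// mulr_ge0.
apply/eqP; rewrite -normr_le0 leNgt; apply/negP => x0.
have := xc (Num.truncn (c / `|(A - 1%:M) *m x|)).+1.
rewrite -ler_pdivlMr// leNgt => /negP; apply.
exact: truncnS_gt.
Qed.

(** * Word and conjugator lengths for a fixed finite generating set *)

Section FixedGeneratingSet.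
Variable S : set (isom R n).
Hypothesis genS : finite_generating_set H S.
Local Notation len := (word_length S).

Lemma gen_in g : H g -> subgroup_gen S g. Proof. by case: genS => _ ->. Qed.

(** The translation part is a sum of k vectors from a finite set, and the remaining rotation lies in
    the finite point group. *)
Lemma word_length_le_tr : exists C : nat, forall g (k : nat), H g ->
  `|isom_tr g| <= k%:R -> (len g <= C * k + C)%N.
Proof.
have [t Lt|F [finF FL] Fsum] := lattice_image_short_sums (M := 1%:M).
  by rewrite mul1mx.
have [C1 FC1] := finite_bounded_nat (fun t => len (translation t)) finF.
have [C2 PC2] := finite_bounded_nat len
  (uniformly_discrete_ball_finite 0 groupH e_gt0 discreteH).
exists (maxn C1 C2) => g k Hg gk; rewrite (translation_rotation g).
have [|u Fu] := Fsum _ k (translationH Hg); first by rewrite mul1mx.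
rewrite !mul1mx => trE; have Su i : subgroup_gen S (translation (u i)).
  exact: gen_in (FL _ (Fu i)).
apply: leq_trans (word_lengthM _ _) _.
- exact: gen_in (translationH Hg).
- exact: gen_in (rotation_in Hg).
apply: leq_add; last first.
  apply: leq_trans (leq_maxr _ _); apply: PC2; split; first exact: rotation_in.
  by rewrite rotation_tr normr0.
rewrite trE translation_sum.
apply: leq_trans (word_length_prod_le (C := C1) _ _) _.
  by move=> i; split; [exact: Su|exact: FC1].
rewrite -[index_enum _]enumT -[(_ * k)%N]/(_ * k)%N size_enum_ord leq_mul2r.
by rewrite leq_maxl orbT.
Qed.

Lemma tr_le_word_length : exists C : nat, forall g, H g ->
  `|isom_tr g| <= (C * len g)%:R.
Proof.
have [finS SH] := genS.
(* Words may use inverses of generators, so both g and g^-1 are measured. *)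
pose f g := (Num.truncn `|isom_tr g| + Num.truncn `|isom_tr g^-1%g|).+2.
have [C SC] := finite_bounded_nat f finS.
have wordC w x : is_word S w -> x \in w -> `|isom_tr x| <= C%:R.
  move=> Sw /Sw [] /SC fC.
    apply: le_trans (ltW (truncnS_gt _)) _; rewrite ler_nat.
    by apply: leq_trans fC; rewrite ltnS ltnW// ltnS leq_addr.
  rewrite -[x]invgK; apply: le_trans (ltW (truncnS_gt _)) _; rewrite ler_nat.
  by apply: leq_trans fC; rewrite ltnS ltnW// ltnS leq_addl.
exists (n * C)%N => g /gen_in/word_lengthP[w [Sw <- <-]].
(* The induction carries a prefix h and appends letters on its right: each adds at most n C.
   Prepending a letter would instead multiply the bound for the whole tail by n. *)
suff wordP h : `|isom_tr (h * \prod_(x <- w) x)%g| <=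
    `|isom_tr h| + (n * C * size w)%:R.
  by have := wordP 1%g; rewrite mul1g isom_tr1 normr0 add0r.
elim: w Sw h => [|x w IH] Sw h.
  by rewrite big_nil mulg1 muln0 addr0.
rewrite big_cons mulgA; apply: le_trans (IH _ _) _.
  by move=> y yw; apply: Sw; rewrite inE yw orbT.
rewrite mulnS natrD addrA lerD2r isom_trM.
apply: le_trans (ler_normD _ _) _; rewrite [leRHS]addrC lerD2r.
apply: le_trans (isom_lin_mul_le _ _) _; rewrite natrM ler_wpM2l//.
by apply: wordC Sw _; rewrite mem_head.
Qed.

(** A given conjugator keeps its linear part; only its translation part is replaced by a short
    solution of the same equation. *)
Lemma conj_length_le_word_length : exists K : nat, forall h h', H h -> H h' ->
  conjugators H h h' !=set0 ->
  (conj_length H S h h' <= K * (len h + len h') + K)%N.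
Proof.
have [C1 lenC1] := word_length_le_tr.
have [C2 trC2] := tr_le_word_length.
have [H1 HM HV] := groupH.
(* The value 0 outside H makes the constant a total function of g, as [choice] requires. *)
have pre (g : isom R n) : exists C : nat, H g -> forall t (k : nat), L t ->
    `|(1%:M - isom_lin g) *m t| <= k%:R ->
    exists2 s, L s /\ (1%:M - isom_lin g) *m s = (1%:M - isom_lin g) *m t
    & `|s| <= (C * k)%:R.
  have [Hg|nHg] := pselect (H g); last by exists 0%N.
  have [t Lt|C preC] := @bounded_preimage (1%:M - isom_lin g); last by exists C.
  by rewrite mulmxBl mul1mx; exact/latticeD/latticeN/lattice_lin.
have [c cP] := choice pre.
have [C3 PC3] := finite_bounded_nat c
  (uniformly_discrete_ball_finite 0 groupH e_gt0 discreteH).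
(* The equation involves only the linear part, so g may be replaced by its rotation; the point group
   being finite, one constant serves all g. *)
have {pre c cP PC3} preC g t (k : nat) : H g -> L t ->
    `|(1%:M - isom_lin g) *m t| <= k%:R ->
    exists2 s, L s /\ (1%:M - isom_lin g) *m s = (1%:M - isom_lin g) *m t
    & `|s| <= (C3 * k)%:R.
  rewrite -rotation_lin => /rotation_in Hg Lt tk.
  have [s sP sk] := cP _ Hg t k Lt tk; exists s => //.
  apply: le_trans sk _; rewrite ler_nat leq_mul2r PC3 ?orbT//.
  by split=> //; rewrite rotation_tr normr0.
exists (C1 * C3 * C2 * n.+1 + C1)%N => h h' Hh Hh' [k [Hk kE]].
have linE : isom_lin h' *m isom_lin k = isom_lin k *m isom_lin h.
  by rewrite -kE !isom_linM isom_linV -!mulmxA isom_linTK mulmx1.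
(* Compare the translation parts of k h = h' k. *)
have trE : (1%:M - isom_lin h') *m isom_tr k =
    isom_tr h' - isom_lin k *m isom_tr h.
  have := congr1 (@isom_tr R n) (canRL (mulgVK _) kE).
  rewrite isom_trM [in RHS]isom_trM => E.
  rewrite mulmxBl mul1mx; apply/eqP; rewrite subr_eq addrAC eq_sym subr_eq.
  by rewrite [isom_tr h' + _]addrC -E addrC.
(* This bounds |t' - B t|, the factor n coming from the orthogonal matrix B. *)
pose m := (C2 * len h' + n * (C2 * len h))%N.
have [|s [Ls sE] sm] := preC h' (isom_tr k) m Hh' (translationH Hk).
  rewrite trE; apply: le_trans (ler_normB _ _) _.
  rewrite natrD lerD ?trC2//; apply: le_trans (isom_lin_mul_le _ _) _.
  by rewrite [leRHS]natrM ler_wpM2l// trC2.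
pose k' := (translation s * rotation k)%g.
have k'lin : isom_lin k' = isom_lin k.
  by rewrite isom_linM translation_lin rotation_lin mul1mx.
have k'tr : isom_tr k' = s.
  by rewrite isom_trM translation_lin rotation_tr mul1mx add0r.
have Hk' : H k' by apply: HM => //; exact: rotation_in.
apply: leq_trans (conj_length_le S (k := k') _) _.
  split=> //; apply: (canLR (mulgK _)); apply: isom_inj; last first.
    by rewrite [LHS]isom_linM [RHS]isom_linM k'lin linE.
  rewrite [LHS]isom_trM [RHS]isom_trM k'lin k'tr.
  have := etrans sE trE; rewrite mulmxBl mul1mx => /eqP.
  rewrite subr_eq addrAC eq_sym subr_eq => /eqP E.
  by rewrite addrC -E addrC.
apply: leq_trans (lenC1 k' (C3 * m)%N Hk' _) _; first by rewrite k'tr.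
rewrite /m.
have mle : (C2 * len h' + n * (C2 * len h) <= C2 * n.+1 * (len h + len h'))%N.
  by nia.
have : (C1 * C3 * (C2 * len h' + n * (C2 * len h)) <=
        C1 * C3 * (C2 * n.+1 * (len h + len h')))%N.
  by rewrite leq_mul2l mle orbT.
by nia.
Qed.

Lemma conj_length_ge_linear g : H g -> isom_lin g <> 1%:M ->
  exists K : nat, forall m : nat, exists h h',
    [/\ H h, H h', conjugators H h h' !=set0, (len h + len h' <= K * m + K)%N
      & (m <= K * conj_length H S h h')%N].
Proof.
move=> Hg g1; pose A := isom_lin g; pose M := 1%:M - A.
have [H1 HM HV] := groupH.
(* Otherwise A would fix L pointwise and be the identity. *)
have [b Lb Mb] : exists2 b, L b & M *m b <> 0.
  apply: contrapT => noB; apply: g1; apply: lin_fixes_lattice => t Lt.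
  apply: contrapT => At; apply: noB; exists t => //.
  by rewrite mulmxBl mul1mx => /eqP; rewrite subr_eq0 eq_sym => /eqP.
have Mb0 : 0 < `|M *m b| by rewrite normr_gt0; exact/eqP.
have [C1 lenC1] := word_length_le_tr.
have [C2 trC2] := tr_le_word_length.
(* [c] makes the length of h' at most linear in m; [C3] turns m |M b| <= n |M| C2 len k into m <= C3
   len k. *)
pose c := (Num.truncn `|M *m b|).+1.
pose C3 := (Num.truncn (n%:R * `|M| * C2%:R / `|M *m b|)).+1.
exists (C1 * c + 2 * C1 + C3)%N => m.
pose h := rotation g; pose t := b *+ m.
have Hh : H h by exact: rotation_in.
have Lt : L t by exact: lattice_natmul.
pose h' := (translation t * h * (translation t)^-1)%g.
have Hh' : H h' by apply: (HM); [exact: HM|exact: HV].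
have h'lin : isom_lin h' = A.
  rewrite /h' -translationN [LHS]isom_linM [isom_lin (_ * _)%g]isom_linM.
  by rewrite !translation_lin mul1mx mulmx1 rotation_lin.
have h'tr : isom_tr h' = M *m t.
  rewrite /h' -translationN [LHS]isom_trM [isom_tr (_ * _)%g]isom_trM.
  rewrite [isom_lin (_ * _)%g]isom_linM !translation_tr !translation_lin.
  rewrite rotation_tr rotation_lin mulmx0 add0r mul1mx mulmxN mulmxBl mul1mx.
  by rewrite addrC.
have normMt : `|M *m t| = m%:R * `|M *m b|.
  by rewrite /t -scaler_nat -scalemxAr normrZ normr_nat.
have clh : conjugators H h h' !=set0 by exists (translation t).
exists h, h'; split=> //.
  have lh : (len h <= C1 * 0 + C1)%N.
    by apply: lenC1 => //; rewrite rotation_tr normr0.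
  have lh' : (len h' <= C1 * (m * c) + C1)%N.
    apply: lenC1 => //; rewrite h'tr normMt natrM ler_wpM2l//.
    exact/ltW/truncnS_gt.
  by nia.
have [k [Hk kE] <-] := conj_lengthP S clh.
have MtE : M *m isom_tr k = M *m t.
  have := congr1 (@isom_tr R n) (canRL (mulgVK _) kE).
  rewrite isom_trM [in RHS]isom_trM rotation_tr mulmx0 add0r h'lin h'tr => E.
  by apply/eqP; rewrite {1}/M mulmxBl mul1mx subr_eq addrC -E.
have : m%:R * `|M *m b| <= n%:R * `|M| * (C2 * len k)%:R.
  rewrite -normMt -MtE; apply: le_trans (mx_norm_mulmx_le _ _) _.
  by rewrite ler_wpM2l ?trC2// mulr_ge0.
rewrite natrM mulrA -ler_pdivlMr// mulrAC => mk.
have : (m <= C3 * len k)%N.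
  rewrite -(ler_nat R); apply: le_trans mk _; rewrite natrM ler_wpM2r//.
  exact/ltW/truncnS_gt.
by nia.
Qed.

End FixedGeneratingSet.

Lemma lattice_by_point_group_CL_grows_linearly g :
  H g -> isom_lin g <> 1%:M -> CL_grows_linearly R H.
Proof.
move=> Hg g1; split; first exact: finitely_generated.
move=> S genS.
have [K1 ub] := conj_length_le_word_length genS.
have [K2 lb] := conj_length_ge_linear genS Hg g1.
apply: (@CL_real_grows_linearly _ _ _ _ groupH (K1 + K2)%N).
  by move=> h h' Hh Hh' cl; apply: leq_trans (ub h h' Hh Hh' cl) _; nia.
move=> m; have [h [h' [Hh Hh' cl lm mcl]]] := lb m.
by exists h, h'; split=> //; nia.
Qed.

End LatticeByPointGroup.

(** * Split crystallographic groups *)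

Section SplitCrystallographic.
Variables (R : realType) (n : nat) (H : set (isom R n)).

Lemma nbhs_isom1 (V : set (isom R n)) : nbhs (1%g : isom R n) V ->
  exists2 e : R, 0 < e & forall g : isom R n,
    `|isom_tr g| < e -> `|isom_lin g - 1%:M| < e -> V g.
Proof.
rewrite nbhsE => -[U [[A oA AU] U1] UV].
have A1 : A (0, 1%:M) by move: U1; rewrite -AU.
have /nbhs_ballP[e /= e0 eA] : nbhs ((0, 1%:M) : 'cV[R]_n * 'M[R]_n) A.
  by apply: open_nbhs_nbhs; split.
exists e => // g tre line; apply: UV; rewrite -AU; apply: eA.
split; rewrite /= mx_norm_ball /ball_/= distrC ?subr0//.
Qed.

(** In the decomposition g = x y the factor y fixes the origin, so x is the translation by the
    translation part of g. *)
Lemma split_translationP g : is_split H -> H g -> H (translation (isom_tr g)).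
Proof.
move=> [_ _ _ HE]; rewrite {1}HE => -[x [Hx xlin] [y [_ ytr] <-]].
suff -> : translation (isom_tr (x * y)%g) = x by [].
apply: isom_inj; rewrite ?translation_tr ?translation_lin //.
by rewrite isom_trM ytr mulmx0 add0r.
Qed.

Lemma discrete_uniformly : is_subgroup H -> is_discrete H ->
  exists2 e : R, 0 < e & forall g, H g ->
    `|isom_tr g| < e -> `|isom_lin g - 1%:M| < e -> g = 1%g.
Proof.
move=> [H1 _ _] /(_ _ H1)[_ [V /nbhs_isom1[e e0 eV] VH]].
exists e => // g Hg tre line.
suff : [set 1%g] g by [].
by rewrite -VH; split=> //; exact: eV.
Qed.

(** Writing x = A k + t with k in the compact set, x - t = A k is bounded. *)
Lemma split_cocompact_dense : is_split H -> is_cocompact H ->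
  exists D : R, forall x, exists2 t, H (translation t) & `|x - t| <= D.
Proof.
move=> splitH [K [/compact_bounded[M [_ MK]] KT]].
exists (n%:R * (M + 1)) => x.
have [h Hh [k Kk <-]] : (\bigcup_(h in H) (isom_act h @` K)) x by rewrite KT.
exists (isom_tr h); first exact: split_translationP.
rewrite /isom_act addrK; apply: le_trans (isom_lin_mul_le _ _) _.
by rewrite ler_wpM2l//; apply: MK; rewrite ?ltrDl.
Qed.

Lemma split_crystallographic_CL_grows_linearly :
  is_crystallographic H -> is_split H -> ~ is_abelian H ->
  CL_grows_linearly R H.
Proof.
move=> [groupH /(discrete_uniformly groupH)[e e0 discH] cocH] splitH nabH.
have [D denseH] := split_cocompact_dense splitH cocH.
(* A group consisting of translations only would be abelian. *)
have [g Hg g1] : exists2 g, H g & isom_lin g <> 1%:M.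
  apply: contrapT => lin1; apply: nabH => x y Hx Hy.
  have {}lin1 z : H z -> isom_lin z = 1%:M.
    by move=> Hz; apply: contrapT => z1; apply: lin1; exists z.
  apply: isom_inj; last by rewrite [LHS]isom_linM [RHS]isom_linM !lin1.
  by rewrite [LHS]isom_trM [RHS]isom_trM !lin1// !mul1mx addrC.
apply: (lattice_by_point_group_CL_grows_linearly groupH _ e0 discH denseH Hg g1).
by move=> h; exact: split_translationP.
Qed.

End SplitCrystallographic.

(** * Affine Coxeter groups *)

Section AffineCoxeter.
Variables (R : realType) (n : nat).
Implicit Types (x y a b : 'cV[R]_n) (g : isom R n).

Lemma dotE x y : dot x y = (x^T *m y) 0 0.
Proof. by rewrite mxE; apply: eq_bigr => i _; rewrite mxE. Qed.

Lemma dotC x y : dot x y = dot y x.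
Proof. by apply: eq_bigr => i _; rewrite mulrC. Qed.

Lemma dotDl x y a : dot (x + y) a = dot x a + dot y a.
Proof. by rewrite !dotE raddfD mulmxDl mxE. Qed.

Lemma dotNl x a : dot (- x) a = - dot x a.
Proof. by rewrite !dotE raddfN mulNmx mxE. Qed.

Lemma dotZl (c : R) x a : dot (c *: x) a = c * dot x a.
Proof. by rewrite !dotE linearZ /= -scalemxAl mxE. Qed.

Lemma dotZr (c : R) x a : dot x (c *: a) = c * dot x a.
Proof. by rewrite dotC dotZl dotC. Qed.

Lemma dot_mulmx (A : 'M[R]_n) x y : dot (A *m x) y = dot x (A^T *m y).
Proof. by rewrite !dotE trmx_mul mulmxA. Qed.

Lemma dot_self_eq0 x : dot x x = 0 -> x = 0.
Proof.
move=> /psumr_eq0P x0; apply/matrixP => i j; rewrite !ord1 mxE.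
apply/eqP; rewrite -sqrf_eq0 expr2; apply/eqP/x0 => // k _.
by rewrite -expr2 sqr_ge0.
Qed.

Lemma dot_norm_le x y : `|dot x y| <= n%:R * `|x| * `|y|.
Proof.
rewrite dotE; apply: le_trans (entry_le_mx_norm _ _ _) _.
apply: le_trans (mx_norm_mulmx_le _ _) _.
rewrite ler_wpM2r// ler_wpM2l//; apply: ler_mx_norm => // i j.
by rewrite mxE entry_le_mx_norm.
Qed.

Lemma int_norm_lt1 (c : R) : c \is a Num.int -> `|c| < 1 -> c = 0.
Proof.
move=> /intrP[m ->]; rewrite -intr_norm -[1]/(1%:~R) ltr_int => m1.
by have -> : m = 0 by lia.
Qed.

Definition reflection_mx a : 'M[R]_n := 1%:M - (2 / dot a a) *: (a *m a^T).

Lemma reflection_mx_tr a : (reflection_mx a)^T = reflection_mx a.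
Proof. by rewrite linearB linearZ /= trmx1 trmx_mul trmxK. Qed.

Lemma reflection_mxE a x : reflection_mx a *m x = x - dot x a *: coroot a.
Proof.
rewrite mulmxBl mul1mx -scalemxAl -mulmxA; congr (_ - _).
rewrite [a^T *m x]mx11_scalar -dotE mul_mx_scalar !scalerA mulrC.
by rewrite dotC.
Qed.

Lemma reflection_mx0 a x : reflection_mx a *m x = affine_reflection a 0 x.
Proof. by rewrite reflection_mxE /affine_reflection subr0. Qed.

Lemma dot_coroot a : a != 0 -> dot (coroot a) a = 2.
Proof.
move=> a0; rewrite dotZl divfK//; apply: contra_neq a0; exact: dot_self_eq0.
Qed.

Lemma reflection_mxK a : a != 0 -> reflection_mx a *m reflection_mx a = 1%:M.
Proof.
move=> a0; apply/matrixP => i j.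
have E x : reflection_mx a *m (reflection_mx a *m x) = x.
  rewrite !reflection_mxE dotDl dotNl dotZl dot_coroot//.
  rewrite -addrA -opprD -scalerDl.
  have -> : dot x a + (dot x a - dot x a * 2) = 0 by ring.
  by rewrite scale0r subr0.
have /matrixP/(_ i 0) := E (delta_mx j 0).
by rewrite mulmxA -colE !mxE eqxx andbT.
Qed.

Lemma affine_reflection_pred a (k : R) : a != 0 ->
  isom_pred (k *: coroot a, reflection_mx a).
Proof. by move=> a0; rewrite /isom_pred/= reflection_mx_tr reflection_mxK. Qed.

Definition isom_reflection a (k : R) (a0 : a != 0) : isom R n :=
  Isom (affine_reflection_pred k a0).

Lemma isom_reflectionE a k (a0 : a != 0) :
  isom_act (isom_reflection k a0) =1 affine_reflection a k.
Proof.
move=> x; rewrite /isom_act /= /isom_lin /isom_tr /= reflection_mxE.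
by rewrite /affine_reflection scalerBl opprB addrA addrAC.
Qed.

Variable Phi : seq 'cV[R]_n.
Hypothesis rootPhi : is_root_system Phi.
Let W := affine_weyl Phi.

Let Phi_neq0 a : a \in Phi -> a != 0.
Proof.
by case: rootPhi => -[Phi0 _] _ _ _; apply: contraTneq => ->.
Qed.

Lemma root_span x : exists c : 'I_(size Phi) -> R, x = \sum_i c i *: Phi`_i.
Proof.
have [[_ Phispan] _ _ _] := rootPhi.
have : x \in <<in_tuple Phi>>%VS by rewrite /= Phispan memvf.
by move=> /coord_span xE; exists (fun i => coord (in_tuple Phi) i x).
Qed.

Lemma root_mem (i : 'I_(size Phi)) : Phi`_i \in Phi.
Proof. exact: mem_nth. Qed.

(** As the roots span, such an x is orthogonal to itself. *)
Lemma root_dot_eq0 x : (forall a, a \in Phi -> dot x a = 0) -> x = 0.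
Proof.
move=> x0; apply: dot_self_eq0; have [c {2}->] := root_span x.
rewrite dotC; elim/big_ind : _ => [|y z y0 z0|i _].
- by rewrite -(scale0r 0) dotZl mul0r.
- by rewrite dotDl y0 z0 addr0.
- by rewrite dotZl dotC x0 ?mulr0// root_mem.
Qed.

Lemma groupW : is_subgroup W. Proof. exact: subgroup_subgroup_gen. Qed.

Lemma isom_reflection_in a (a0 : a != 0) (k : int) : a \in Phi ->
  W (isom_reflection k%:~R a0).
Proof.
move=> aPhi; apply: sub_gen_smallest; exists a => //; exists k.
exact: isom_reflectionE.
Qed.

(** The product of the reflections in the parallel hyperplanes (x, a) = k and (x, a) = 0 is this
    translation. *)
Lemma coroot_translation_in a (k : int) : a \in Phi ->
  W (translation (k%:~R *: coroot a)).
Proof.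
move=> aPhi; have a0 := Phi_neq0 aPhi; have [_ WM _] := groupW.
have := WM _ _ (isom_reflection_in a0 k aPhi) (isom_reflection_in a0 0 aPhi).
congr W; apply: isom_inj.
  rewrite isom_trM translation_tr /isom_tr /isom_lin /= scale0r mulmx0.
  by rewrite add0r.
by rewrite isom_linM translation_lin [LHS]reflection_mxK.
Qed.

(** The first clause gives splitting, the others discreteness. The clause on the transpose serves
    inverses and, through (A t, b) = (t, A^T b), the integrality for products. *)
Let invariant g := [/\ W (translation (isom_tr g)),
  forall b, b \in Phi -> isom_lin g *m b \in Phi,
  forall b, b \in Phi -> (isom_lin g)^T *m b \in Phi
& forall b, b \in Phi -> dot (isom_tr g) b \is a Num.int].

Lemma rotation_translation g t :
  translation (isom_lin g *m t) =
  (rotation g * translation t * (rotation g)^-1)%g.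
Proof.
apply: (canRL (mulgK _)); apply: isom_inj.
  rewrite [LHS]isom_trM [RHS]isom_trM !translation_tr translation_lin.
  by rewrite rotation_tr mulmx0 !add0r addr0 rotation_lin.
by rewrite [LHS]isom_linM [RHS]isom_linM !translation_lin mul1mx mulmx1.
Qed.

Lemma affine_weyl_invariant g : W g -> invariant g.
Proof.
have [_ reflPhi intPhi _] := rootPhi; have [W1 WM WV] := groupW.
(* Membership in W is carried along, since the product step conjugates a translation by a rotation
   that must lie in W. *)
suff sub : W `<=` [set g | W g /\ invariant g] by move=> /sub[].
have Wlin h t : W h -> W (translation (isom_tr h)) -> W (translation t) ->
    W (translation (isom_lin h *m t)).
  move=> Wh Whtr Wt.
  have Wrot : W (rotation h).
    by apply: WM => //; rewrite translationN; exact: WV.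
  by rewrite rotation_translation; apply: (WM); [exact: WM|exact: WV].
apply: smallest_sub.
  split.
  - split=> //; split=> [|b|b|b _]; rewrite ?isom_tr1 ?isom_lin1 ?translation0//.
    + by rewrite mul1mx.
    + by rewrite trmx1 mul1mx.
    + by rewrite -(scale0r 0) dotZl mul0r.
  - move=> g1 g2 [Wg1 [tr1 lin1 linT1 int1]] [Wg2 [tr2 lin2 linT2 int2]].
    split; first exact: WM.
    rewrite /invariant isom_trM isom_linM; split=> [|b Pb|b Pb|b Pb].
    + by rewrite translationD; apply: WM => //; exact: Wlin.
    + by rewrite -mulmxA; exact/lin1/lin2.
    + by rewrite trmx_mul -mulmxA; exact/linT2/linT1.
    + by rewrite dotDl dot_mulmx rpredD ?int1// int2// linT1.
  - move=> h [Wh [trh linh linTh inth]].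
    have WVh := WV _ Wh.
    have Wtr : W (translation (isom_tr h^-1%g)).
      have -> : translation (isom_tr h^-1%g) = (h^-1 * rotation h)%g.
        apply: isom_inj.
          by rewrite [RHS]isom_trM rotation_tr mulmx0 add0r.
        by rewrite [RHS]isom_linM rotation_lin isom_linV isom_linTK.
      by apply: (WM) => //; apply: WM => //; rewrite translationN; exact: WV.
    split=> //; rewrite /invariant isom_linV trmxK; split=> // b Pb.
    by rewrite isom_trV dotNl dot_mulmx trmxK rpredN inth// linh.
move=> h [a Pa [k hE]]; have a0 := Phi_neq0 Pa.
have -> : h = isom_reflection k%:~R a0.
  by apply: isom_act_inj => x; rewrite hE isom_reflectionE.
split; first exact: isom_reflection_in.
rewrite /invariant /isom_tr /isom_lin /= reflection_mx_tr.
split=> [|b Pb|b Pb|b Pb].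
- exact: coroot_translation_in.
- by rewrite reflection_mx0; exact: reflPhi.
- by rewrite reflection_mx0; exact: reflPhi.
- by rewrite dotZl dotC rpredM ?intr_int// intPhi.
Qed.

(** For g = (t, A) near 1, the integers (t, b) and (A b - b, coroot a) have absolute value below 1,
    so they vanish. Hence t = 0 and A fixes every root. *)
Lemma affine_weyl_discrete : exists2 e : R, 0 < e & forall g, W g ->
  `|isom_tr g| < e -> `|isom_lin g - 1%:M| < e -> g = 1%g.
Proof.
have [_ _ intPhi _] := rootPhi.
have [C PC] := finite_bounded_nat
  (fun a => Num.truncn `|a| + Num.truncn `|coroot a|)%N (finite_seq Phi).
have PhiC a : a \in Phi -> `|a| <= C.+1%:R /\ `|coroot a| <= C.+1%:R.
  by move=> /PC aC; split; apply: le_trans (ltW (truncnS_gt _)) _;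
     rewrite ler_nat ltnS (leq_trans _ aC)// ?leq_addr ?leq_addl.
(* Each pairing or matrix product costs at most n (C + 1) < N, and at most two occur in a row,
   whence e = 1 / N^2. *)
pose N : R := (n.+1 * C.+1)%:R; have N1 : 1 <= N by rewrite ler1n.
have nCN : n%:R * C.+1%:R < N by rewrite -natrM ltr_nat ltn_pmul2r.
have N0 : 0 < N by lra.
exists (N * N)^-1; first by rewrite invr_gt0 mulr_gt0.
move=> g /affine_weyl_invariant[_ linP _ intP] tre line.
have nC0 : 0 <= n%:R * C.+1%:R :> R by rewrite mulr_ge0.
apply: isom_inj.
  apply: root_dot_eq0 => b Pb; apply: int_norm_lt1; first exact: intP.
  apply: le_lt_trans (dot_norm_le _ _) _.
  apply: le_lt_trans (_ : n%:R * C.+1%:R * (N * N)^-1 < _).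
    rewrite mulrAC; apply: ler_pM => //.
      by rewrite ler_wpM2l//; case: (PhiC b Pb).
    exact: ltW.
  rewrite ltr_pdivrMr ?mulr_gt0// mul1r; apply: lt_le_trans nCN _.
  by rewrite ler_peMr// ltW.
suff fix_root b : b \in Phi -> isom_lin g *m b = b.
  apply/eqP; rewrite -subr_eq0; apply/eqP/matrixP => i j.
  have : (isom_lin g - 1%:M) *m delta_mx j 0 = 0 :> 'cV[R]_n.
    have [c ->] := root_span (delta_mx j 0).
    rewrite mulmx_sumr big1// => k _.
    by rewrite -scalemxAr mulmxBl mul1mx fix_root ?root_mem// subrr scaler0.
  by move=> /matrixP/(_ i 0); rewrite -colE !mxE.
move=> Pb; apply/eqP; rewrite -subr_eq0; apply/eqP/root_dot_eq0 => a Pa.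
set d := _ - _.
have : dot d (coroot a) = 0.
  apply: int_norm_lt1.
    by rewrite dotDl dotNl rpredB// intPhi// linP.
  have dle : `|d| <= n%:R * C.+1%:R * (N * N)^-1.
    rewrite /d -{2}[b]mul1mx -mulmxBl; apply: le_trans (mx_norm_mulmx_le _ _) _.
    rewrite mulrAC; apply: ler_pM => //.
      by rewrite ler_wpM2l//; case: (PhiC b Pb).
    exact: ltW.
  apply: le_lt_trans (dot_norm_le _ _) _; rewrite mulrAC.
  apply: le_lt_trans (_ : (n%:R * C.+1%:R) * (n%:R * C.+1%:R * (N * N)^-1) < _).
    apply: ler_pM => //.
    by rewrite ler_wpM2l//; case: (PhiC a Pa).
  rewrite mulrA ltr_pdivrMr ?mulr_gt0// mul1r.
  by apply: ltr_pM.
rewrite dotZr => /eqP; rewrite mulf_eq0 => /orP[|/eqP//].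
rewrite mulf_eq0 invr_eq0 pnatr_eq0/= => /eqP/dot_self_eq0 a0.
by have := Phi_neq0 Pa; rewrite a0 eqxx.
Qed.

Lemma coroot_lattice_dense :
  exists D : R, forall x, exists2 t, W (translation t) & `|x - t| <= D.
Proof.
have [W1 WM _] := groupW.
exists (\sum_(i < size Phi) `|coroot Phi`_i|) => x.
have [c xE] := root_span x.
(* Coefficients of x on the coroots, since a = ((a, a) / 2) coroot a. Rounding them down leaves an
   error of at most one copy of each coroot. *)
pose d (i : 'I_(size Phi)) : R := c i * (dot Phi`_i Phi`_i / 2).
exists (\sum_i (Num.floor (d i))%:~R *: coroot Phi`_i).
  apply: (big_ind (fun t => W (translation t))) => [|s t Ws Wt|i _].
  - by rewrite translation0.
  - by rewrite translationD; exact: WM.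
  - exact: coroot_translation_in (root_mem i).
have -> : x = \sum_i d i *: coroot Phi`_i.
  rewrite xE; apply: eq_bigr => i _; rewrite /coroot scalerA /d; congr (_ *: _).
  have : dot Phi`_i Phi`_i != 0.
    by apply: contra_neq (Phi_neq0 (root_mem i)); exact: dot_self_eq0.
  by move=> ?; field.
rewrite -sumrB; apply: le_trans (ler_norm_sum _ _ _) _.
apply: ler_sum => i _; rewrite -scalerBl normrZ ler_piMl//.
have := floor_itv (d i); rewrite intrD => /andP[d1 d2].
by rewrite ger0_norm; lra.
Qed.

Lemma affine_weyl_CL_grows_linearly : Phi != [::] -> CL_grows_linearly R W.
Proof.
move=> Phi0; have [a Pa] : exists a, a \in Phi.
  by case: Phi Phi0 => // a s _; exists a; rewrite mem_head.
have a0 := Phi_neq0 Pa.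
have [e e0 discW] := affine_weyl_discrete.
have [D denseW] := coroot_lattice_dense.
apply: (lattice_by_point_group_CL_grows_linearly groupW _ e0 discW denseW
  (isom_reflection_in a0 0 Pa)) => [g /affine_weyl_invariant[]//|].
(* The reflection sends a to -a; were it the identity, 2 a would be 0. *)
rewrite /isom_lin /= => lin1.
have := reflection_mxE a a; rewrite lin1 mul1mx => /eqP.
rewrite -subr_eq0 opprB addrCA subrr addr0 /coroot scalerA.
rewrite mulrCA divff ?mulr1; last by apply: contra_neq a0; exact: dot_self_eq0.
by rewrite scaler_eq0 pnatr_eq0 (negbTE a0).
Qed.

End AffineCoxeter.

Theorem corollary1p2 (R : realType) :
  (forall (n : nat) (W : set (isom R n)),
     is_affine_coxeter W -> CL_grows_linearly R W) /\
  (forall (n : nat) (H : set (isom R n)),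
     is_crystallographic H -> is_split H -> ~ is_abelian H ->
     CL_grows_linearly R H).
Proof.
split=> [n W [Phi [Phi0 rootPhi ->]]|n H].
  exact: affine_weyl_CL_grows_linearly.
exact: split_crystallographic_CL_grows_linearly.
Qed.
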